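(* For every integer $n\ge 2$ (for the $g$-values) and every integer $n\ge 1$ (for the $h$-values), the following hold: \begin{itemize} \item $g^{(2)}_{\{0\}}(n)=1$, $g^{(2)}_{\{1\}}(n)=2^{\lfloor n/2\rfloor}$, $g^{(2)}_{\{2\}}(n)=1$, $g^{(2)}_{\{0,1\}}(n)=1+2^{n-1}$, $g^{(2)}_{\{1,2\}}(n)=1+2^{n-1}$, $g^{(2)}_{\{0,2\}}(n)=2^{\lfloor n/2\rfloor}$, $g^{(2)}_{\{0,1,2\}}(n)=2^{n}$; \item $h^{(2)}_{\{0\}}(n)=1$, $h^{(2)}_{\{1\}}(n)=2^{\lfloor n/2\rfloor}$, $h^{(2)}_{\{2\}}(n)=1$, $h^{(2)}_{\{1,2\}}(n)=1$, $h^{(2)}_{\{0,2\}}(n)=1$, $h^{(2)}_{\{0,1,2\}}(n)=1$, and \[ h^{(2)}_{\{0,1\}}(n)=\begin{cases} 3^{n/3} & \text{if } n\equiv 0 \pmod 3,\\ 4\cdot 3^{\lfloor n/3\rfloor-1} & \text{if } n\equiv 1 \pmod 3,\\ 2\cdot 3^{\lfloor n/3\rfloor} & \text{if } n\equiv 2 \pmod 3.\end{cases} \] \end{itemize}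
   Context: An $r$-uniform hypergraph is a finite vertex set with a family of $r$-element subsets (hyperedges); a $2$-uniform hypergraph is a simple graph. A vertex is isolated if it lies in no hyperedge. Given a non-empty set $A$ of non-negative integers, a set $S$ of vertices of an $r$-uniform hypergraph $\mathcal{H}$ is an $A$-transversal if $|H\cap S|\in A$ for every hyperedge $H$ of $\mathcal{H}$; an $A$-transversal is maximal if it is not a proper subset of another $A$-transversal. For $n\ge r$, $g^{(r)}_A(n)$ denotes the maximum number of $A$-transversals in an $r$-uniform hypergraph on $n$ vertices with no isolated vertices. $h^{(r)}_A(n)$ denotes the maximum number of maximal $A$-transversals in an $r$-uniform hypergraph on $n$ vertices (isolated vertices allowed).
   Formalization: The formula for h^{(2)}_{{0,1}}(n) is stated only for n ≥ 2: at n = 1 the printed formula gives 4·3^{-1} = 4/3, while the true value is 1; all other values are as stated. *)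

(* Defs.v *)
From mathcomp Require Import all_boot.

Set Implicit Arguments.
Unset Strict Implicit.
Unset Printing Implicit Defensive.

(* A hypergraph on V is given by its set E of hyperedges. *)
Definition uniform (V : finType) (r : nat) (E : {set {set V}}) : bool :=
  [forall H in E, #|H| == r].

Definition isolated (V : finType) (E : {set {set V}}) (v : V) : bool :=
  [forall H in E, v \notin H].

Definition no_isolated (V : finType) (E : {set {set V}}) : bool :=
  [forall v, ~~ isolated E v].

Definition is_A_transversal (V : finType) (A : {pred nat}) (E : {set {set V}})
    (S : {set V}) : bool :=
  [forall H in E, #|H :&: S| \in A].

Definition is_maximal_A_transversal (V : finType) (A : {pred nat})
    (E : {set {set V}}) (S : {set V}) : bool :=
  is_A_transversal A E S
  && ~~ [exists S' : {set V}, (S \proper S') && is_A_transversal A E S'].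

(* The n vertices are labelled by 'I_n: the numbers of (maximal)              *)
(* A-transversals do not depend on the labelling. A \max over an empty range  *)
(* is 0: the range of h contains set0, and that of g is non-empty whenever    *)
(* 0 < r <= n.                                                                *)
Definition g (r : nat) (A : {pred nat}) (n : nat) : nat :=
  \max_(E : {set {set 'I_n}} | uniform r E && no_isolated E)
    #|[set S : {set 'I_n} | is_A_transversal A E S]|.

Definition h (r : nat) (A : {pred nat}) (n : nat) : nat :=
  \max_(E : {set {set 'I_n}} | uniform r E)
    #|[set S : {set 'I_n} | is_maximal_A_transversal A E S]|.

(* Main.v *)
Require Import Defs.
From mathcomp Require Import all_boot.
From mathcomp Require Import zify.

Set Implicit Arguments.
Unset Strict Implicit.
Unset Printing Implicit Defensive.

(* Adjacent vertices determine each other in a {1}- or a {0,2}-transversal, so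
   such a transversal is determined by its trace on a dominating set with at most
   half of the vertices; a near-perfect matching attains 2 ^ (n %/ 2).  For
   {0,1}, independent sets are paired with their complements: a set independent
   together with its complement is a {1}-transversal, and these are at most as
   many as the unions of connected components, almost none of which is
   independent or has an independent complement; stars attain the bound.  When
   A-transversals are closed under union, only one is maximal.  The maximal
   {0,1}-transversals are the maximal independent sets, counted by the
   Moon-Moser recursion on a vertex of minimum degree. *)

(** * Graphs as 2-uniform hypergraphs; upper bounds for [{1}], [{0,2}] and [{0,1}] *)

Section Graph.
Variables (V : finType) (E : {set {set V}}).

Definition adj : rel V := [rel u v | (u != v) && ([set u; v] \in E)].

Lemma adj_sym : symmetric adj.
Proof. by move=> u v; rewrite /adj /= eq_sym setUC. Qed.

Lemma adj_irr : irreflexive adj.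
Proof. by move=> u; rewrite /adj /= eqxx. Qed.

Lemma card_set2I (u v : V) (S : {set V}) :
  u != v -> #|[set u; v] :&: S| = (u \in S) + (v \in S).
Proof.
move=> uv; rewrite setIUl cardsU.
have c1 x : #|[set x] :&: S| = (x \in S).
  have [xS|xS] := boolP (x \in S); first by rewrite (setIidPl _) ?sub1set ?cards1.
  by apply/eqP; rewrite cards_eq0 setI_eq0 disjoints1.
suff -> : [set u] :&: S :&: ([set v] :&: S) = set0 by rewrite !c1 cards0 subn0.
apply/setP=> x; rewrite !inE; case: (x =P u) => [->|] //=.
by rewrite (negbTE uv) /= andbF.
Qed.

Hypothesis uniE : uniform 2 E.

(** Reading an intersection size as a sum of two truth values turns later arguments about one edge
    into boolean case analyses. *)
Lemma A_transversalP (A : {pred nat}) (S : {set V}) :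
  reflect (forall u v, adj u v -> ((u \in S) + (v \in S))%N \in A)
          (is_A_transversal A E S).
Proof.
apply: (iffP forall_inP) => [tr u v /andP[uv Huv]|tr H HE].
  by rewrite -card_set2I //; exact: tr.
have /cards2P[u [v [uv HH]]] := forall_inP uniE H HE; subst H.
by rewrite card_set2I //; apply: tr; rewrite /adj /= uv.
Qed.

Lemma isolatedPn v : reflect (exists u, adj v u) (~~ isolated E v).
Proof.
apply: (iffP idP) => [/forall_inPn[H HE]|[u /andP[vu Hvu]]].
  have /cards2P[x [y [xy HH]]] := forall_inP uniE H HE; subst H.
  rewrite negbK !inE => /orP[]/eqP->.
    by exists y; rewrite /adj /= xy.
  by exists x; rewrite adj_sym /adj /= xy.
by apply/forall_inPn; exists [set v; u]; rewrite // negbK set21.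
Qed.

Lemma no_isolatedP : reflect (forall v, exists u, adj v u) (no_isolated E).
Proof. by apply: (iffP forallP) => noI v; apply/isolatedPn. Qed.

Lemma maximal_A_transversalP (A : {pred nat}) (S : {set V}) :
  reflect (is_A_transversal A E S /\
           forall S' : {set V}, S \subset S' -> is_A_transversal A E S' -> S' = S)
          (is_maximal_A_transversal A E S).
Proof.
apply: (iffP andP) => [[tS /existsPn mS]|[tS mS]]; split=> //.
  move=> S' sSS' tS'; apply/eqP; rewrite eq_sym eqEproper sSS' /=.
  by apply: contra (mS S') => ->.
apply/existsPn=> S'; apply/negP=> /andP[pSS' tS'].
by have := pSS'; rewrite (mS _ (proper_sub pSS') tS') properxx.
Qed.

(** Adding an isolated vertex changes no intersection with an edge. This fixes the trace on isolated
    vertices when maximal [{1}]-transversals are counted. *)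
Lemma maximal_transversal_isolated (A : {pred nat}) (S : {set V}) v :
  is_maximal_A_transversal A E S -> isolated E v -> v \in S.
Proof.
case/maximal_A_transversalP=> /A_transversalP tS mS isov.
rewrite -(mS (v |: S)) ?setU11 ?subsetUr //.
have nv u w : adj u w -> (u != v) /\ (w != v).
  by move=> uw; split; apply: contraL isov => /eqP<-; apply/isolatedPn;
    [exists w | exists u; rewrite adj_sym].
apply/A_transversalP=> u w uw; have [/negbTE nu /negbTE nw] := nv _ _ uw.
by rewrite !inE nu nw; apply: tS.
Qed.

(* Ore's bound: a maximal independent set and its complement both dominate the
   non-isolated vertices, and one of the two has at most half of the vertices. *)
Lemma half_dominating :
  exists2 D : {set V}, #|D| <= #|V| %/ 2 &
    forall v, ~~ isolated E v -> v \notin D -> exists2 u, u \in D & adj v u.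
Proof.
pose ind (S : {set V}) := [forall u in S, forall v in S, ~~ adj u v].
have ind0 : ind set0 by apply/forall_inP=> u; rewrite inE.
have [M /maxsetP[indM maxM] _] := maxset_exists ind0.
have nindM u v : u \in M -> v \in M -> adj u v = false.
  by move=> uM vM; apply/negbTE/(forall_inP (forall_inP indM u uM)).
have [le|lt] := leqP #|M| (#|V| %/ 2).
  (* A vertex without a neighbour in [M] could be added to [M], against maximality. *)
  exists M => // v _ vM; apply/exists_inP; apply: contraNT vM => /exists_inPn nv.
  suff <- : v |: M = M by rewrite setU11.
  apply: maxM; last exact: subsetUr.
  apply/forall_inP=> x; rewrite 2!inE => /predU1P[->|xM];
    apply/forall_inP=> y; rewrite 2!inE => /predU1P[->|yM].
  - by rewrite adj_irr.
  - exact: nv.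
  - by rewrite adj_sym; exact: nv.
  - by rewrite nindM.
(* Here [M] has more than half of the vertices, so its complement has at most [#|V| %/ 2]. As [M] is
   independent, every neighbour of a vertex of [M] lies in the complement. *)
exists (~: M); first by have := cardsC M; lia.
move=> v /isolatedPn[u vu]; rewrite inE negbK => vM; exists u => //.
by rewrite inE; apply: contraL vu => uM; rewrite nindM.
Qed.

(** Intersection with the set [D] of [half_dominating] is injective on [F]: a non-isolated vertex
    outside [D] is decided by a neighbour in [D], and the second hypothesis settles the isolated
    vertices, which [D] need not dominate. *)
Lemma card_determined_by_neighbours (F : {set {set V}}) :
  (forall S T, S \in F -> T \in F -> forall u v, adj u v ->
     (v \in S) = (v \in T) -> (u \in S) = (u \in T)) ->
  (forall S T v, S \in F -> T \in F -> isolated E v -> (v \in S) = (v \in T)) ->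
  #|F| <= 2 ^ (#|V| %/ 2).
Proof.
move=> detN detI; have [D leD domD] := half_dominating.
apply: (@leq_trans #|powerset D|); last by rewrite card_powerset leq_exp2l.
have injF : {in F &, injective (fun S => S :&: D)}.
  move=> S T SF TF /setP eqST.
  have eqD v : v \in D -> (v \in S) = (v \in T).
    by move=> vD; have := eqST v; rewrite !inE vD !andbT.
  apply/setP=> v; have [iv|niv] := boolP (isolated E v); first exact: detI.
  have [/eqD //|vD] := boolP (v \in D).
  by have [u uD vu] := domD v niv vD; apply: detN vu (eqD u uD).
rewrite -(card_in_imset injF); apply/subset_leq_card/subsetP=> _ /imsetP[S _ ->].
by rewrite powersetE subsetIr.
Qed.

Lemma card_transversals02 :
  no_isolated E ->
  #|[set S | is_A_transversal (pred2 0 2) E S]| <= 2 ^ (#|V| %/ 2).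
Proof.
move=> noI; apply: card_determined_by_neighbours => S T; rewrite !inE.
  move=> /A_transversalP tS /A_transversalP tT u v uv.
  move: (tS u v uv) (tT u v uv); rewrite !inE.
  by case: (u \in S); case: (v \in S); case: (u \in T); case: (v \in T).
by move=> v _ _; rewrite (negbTE (forallP noI v)).
Qed.

Lemma transversal1_det (S T : {set V}) u v :
  is_A_transversal (pred1 1) E S -> is_A_transversal (pred1 1) E T -> adj u v ->
  (v \in S) = (v \in T) -> (u \in S) = (u \in T).
Proof.
move=> /A_transversalP tS /A_transversalP tT uv.
move: (tS u v uv) (tT u v uv); rewrite !inE.
by case: (u \in S); case: (v \in S); case: (u \in T); case: (v \in T).
Qed.

Lemma card_transversals1 :
  no_isolated E ->
  #|[set S | is_A_transversal (pred1 1) E S]| <= 2 ^ (#|V| %/ 2).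
Proof.
move=> noI; apply: card_determined_by_neighbours => S T; rewrite !inE.
  by move=> tS tT u v; apply: transversal1_det.
by move=> v _ _; rewrite (negbTE (forallP noI v)).
Qed.

Lemma card_maximal_transversals1 :
  #|[set S | is_maximal_A_transversal (pred1 1) E S]| <= 2 ^ (#|V| %/ 2).
Proof.
apply: card_determined_by_neighbours => S T; rewrite !inE.
  by move=> /andP[tS _] /andP[tT _] u v; apply: transversal1_det.
by move=> v mS mT isov; rewrite !(maximal_transversal_isolated (A := pred1 1)).
Qed.

Lemma transversal01E S :
  is_A_transversal (pred2 0 1) E S = [forall u in S, forall v in S, ~~ adj u v].
Proof.
apply/A_transversalP/forall_inP => [tS u uS|tS u v uv].
  apply/forall_inP=> v vS; apply: contraL isT => uv.
  by have := tS u v uv; rewrite uS vS.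
have [uS|] := boolP (u \in S); last by case: (v \in S).
have [vS|//] := boolP (v \in S).
by move: uv; rewrite (negbTE (forall_inP (tS u uS) v vS)).
Qed.

(** An edge that meets [S] in [i] vertices meets the complement in [2 - i]. *)
Lemma transversal_setC (A B : {pred nat}) S :
  (forall i, i <= 2 -> (i \in A) = (2 - i \in B)) ->
  is_A_transversal A E (~: S) = is_A_transversal B E S.
Proof.
move=> AB; apply/A_transversalP/A_transversalP=> tS u v /tS;
  rewrite !inE AB; by case: (u \in S); case: (v \in S).
Qed.

Lemma card_transversals_setC (A B : {pred nat}) :
  (forall i, i <= 2 -> (i \in A) = (2 - i \in B)) ->
  #|[set S | is_A_transversal A E S]| = #|[set S | is_A_transversal B E S]|.
Proof.
move=> AB; rewrite -(card_preimset _ (@setC_inj V)).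
by apply: eq_card => S; rewrite !inE (transversal_setC _ AB).
Qed.

(* Symmetric difference with a fixed {1}-transversal. *)
Lemma card_transversals1_le02 :
  #|[set S | is_A_transversal (pred1 1) E S]|
    <= #|[set S | is_A_transversal (pred2 0 2) E S]|.
Proof.
set B := [set S | _]; set C := [set S | _].
have [->|[S0]] := set_0Vmem B; first by rewrite cards0.
rewrite inE => /A_transversalP tS0.
pose f (S : {set V}) := [set v | (v \in S) (+) (v \in S0)].
have injf : injective f.
  by move=> S T /setP eqf; apply/setP=> v; have := eqf v; rewrite !inE => /addIb.
rewrite -(card_imset _ injf); apply/subset_leq_card/subsetP=> _ /imsetP[S + ->].
rewrite !inE => /A_transversalP tS; apply/A_transversalP=> u v uv; move: (tS0 u v uv) (tS u v uv).
by rewrite !inE; case: (u \in S); case: (v \in S); case: (u \in S0); case: (v \in S0).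
Qed.

(* With I the independent sets and J their complements, I :&: J is the set of
   {1}-transversals, while I :|: J misses every {0,2}-transversal other than
   the empty and the full set. *)
Lemma card_transversals01 :
  0 < #|V| -> no_isolated E ->
  #|[set S | is_A_transversal (pred2 0 1) E S]| <= 1 + 2 ^ (#|V| - 1).
Proof.
move=> V0 /no_isolatedP noI.
set I := [set S | _]; pose J := [set S | is_A_transversal (pred2 1 2) E S].
pose B := [set S | is_A_transversal (pred1 1) E S].
pose C := [set S | is_A_transversal (pred2 0 2) E S].
have cJ : #|J| = #|I| by apply: card_transversals_setC; do 3!case=> //.
have IJ : I :&: J = B.
  apply/setP=> S; rewrite !inE; apply/andP/A_transversalP => [[]|tS].
    move=> /A_transversalP t1 /A_transversalP t2 u v uv.
    by move: (t1 u v uv) (t2 u v uv); case: (u \in S); case: (v \in S).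
  by split; apply/A_transversalP=> u v /tS; case: (u \in S); case: (v \in S).
pose C' := C :\: [set set0; setT].
have cC' : #|C| <= #|C'| + 2.
  have := cardsID [set set0; setT] C; rewrite -/C'.
  have : #|C :&: [set set0; setT]| <= 2.
    apply: leq_trans (subset_leq_card (subsetIr _ _)) _.
    by rewrite cards2; case: (_ != _).
  by move=> *; lia.
have dis : [disjoint C' & I :|: J].
  (* A [{0,2}]-transversal contains both or neither end of each edge. A vertex inside [S] and a
     neighbour of it show that [S] is not independent; a vertex outside and a neighbour of it show
     that the complement is not. *)
  rewrite disjoint_subset; apply/subsetP=> S; rewrite !inE negb_or.
  case/andP=> /andP[S0 ST] /A_transversalP tS; rewrite negb_or; apply/andP; split.
    have /set0Pn[v vS] := S0; have [u vu] := noI v.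
    by apply/negP=> /A_transversalP/(_ v u vu); have := tS v u vu; rewrite vS; case: (u \in S).
  have /set0Pn[v] : ~: S != set0 by apply: contraNneq ST => SC; rewrite -[S]setCK SC setC0.
  rewrite inE => /negbTE vS; have [u vu] := noI v.
  by apply/negP=> /A_transversalP/(_ v u vu); have := tS v u vu; rewrite vS; case: (u \in S).
have cU : #|C'| + #|I :|: J| <= 2 ^ #|V|.
  rewrite -cardsUI (disjoint_setI0 dis) cards0 addn0 -cardsT -card_powerset powersetT.
  by apply/subset_leq_card/subsetP=> S; rewrite inE.
have cIJ : #|I :|: J| + #|B| = #|I| + #|I|.
  by rewrite -IJ cardsUI cJ.
(* Altogether [2 * #|I| = #|I :|: J| + #|B| <= #|I :|: J| + #|C'| + 2 <= 2 ^ #|V| + 2], to be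
   halved. *)
have := card_transversals1_le02; rewrite -/B -/C.
have : 2 ^ #|V| = 2 * 2 ^ (#|V| - 1) by rewrite -expnS subn1 prednK.
lia.
Qed.

End Graph.

(** * The Moon-Moser numbers *)

(** The maximum number of maximal independent sets on [n] vertices. Tripling would give only 3 at
    [n = 4], where two disjoint edges have 4. *)
Fixpoint moon_moser (n : nat) : nat :=
  match n with
  | 0 | 1 => 1
  | 2 => 2
  | m.+3 => if m == 1 then 4 else 3 * moon_moser m
  end.

Lemma moon_moserS3 n :
  moon_moser n.+3 = if n == 1 then 4 else 3 * moon_moser n.
Proof. by []. Qed.

Arguments moon_moser : simpl never.

Lemma moon_moser_add1 n : moon_moser n <= moon_moser n.+1.
Proof.
elim/ltn_ind: n => -[|[|[|n]]] // IH; have := IH n (leqW (leqW (leqnn _))).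
rewrite !moon_moserS3.
by case: n {IH} => [|[|n]] //=; lia.
Qed.

Lemma moon_moser_add2 n : 2 * moon_moser n <= moon_moser n.+2.
Proof.
elim/ltn_ind: n => -[|[|[|n]]] // IH; have := IH n (leqW (leqW (leqnn _))).
rewrite !moon_moserS3.
by case: n {IH} => [|[|n]] //=; lia.
Qed.

Lemma moon_moser_add3 n : 3 * moon_moser n <= moon_moser n.+3.
Proof. by rewrite moon_moserS3; case: eqP => [->|]. Qed.

Lemma moon_moser_leq m n : m <= n -> moon_moser m <= moon_moser n.
Proof.
move=> /subnK <-; elim: (n - m) => // k IH.
exact: leq_trans IH (moon_moser_add1 _).
Qed.

(** The inequality behind the branching: [k] branches, each with [k] vertices removed. The factor 4
    is two doublings, and from 5 on [k <= 3 * (k - 3)] reduces to [k - 3]. *)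
Lemma moon_moser_mul k m : k * moon_moser m <= moon_moser (m + k).
Proof.
elim/ltn_ind: k => -[|[|[|[|[|k]]]]] IH.
- by rewrite mul0n.
- by rewrite mul1n addn1 moon_moser_add1.
- by rewrite addn2 moon_moser_add2.
- by rewrite addn3 moon_moser_add3.
- rewrite addn4; have := moon_moser_add2 m; have := moon_moser_add2 m.+2; lia.
have := IH k.+2 ltac:(lia); have := moon_moser_add3 (m + k.+2).
by rewrite -!addnS; nia.
Qed.

(** At [n = 1] the truncated exponent [0 - 1] would make the closed form 4 instead of 1. *)
Lemma moon_moserE n : n <> 1 ->
  moon_moser n = if n %% 3 == 0 then 3 ^ (n %/ 3)
                 else if n %% 3 == 1 then 4 * 3 ^ (n %/ 3 - 1)
                 else 2 * 3 ^ (n %/ 3).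
Proof.
elim/ltn_ind: n => -[|[|[|n]]] // IH _; rewrite moon_moserS3.
case: eqP => [->|n1] //; rewrite {}IH //; last by lia.
rewrite -(addn3 n) modnDr divnDr // divnn /= addn1.
case: (n %% 3 =P 0) => _; first by rewrite expnS.
case: (n %% 3 =P 1) => n3; last by rewrite expnS mulnCA.
(* Since [n] is 1 modulo 3 and differs from 1, the quotient is positive and the subtraction is not
   truncated. *)
have -> : (n %/ 3).+1 - 1 = (n %/ 3 - 1).+1 by lia.
by rewrite expnS mulnCA.
Qed.

(** * The Moon-Moser upper bound on maximal independent sets *)

Lemma leq_card_bigcup (I T : finType) (P : pred I) (F : I -> {set T}) :
  #|\bigcup_(i | P i) F i| <= \sum_(i | P i) #|F i|.
Proof.
elim/big_rec2: _ => [|i m A _ IH]; first by rewrite cards0.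
by apply: leq_trans (leq_card_setU _ _) _; rewrite leq_add2l.
Qed.

Section MaximalIndependentSets.
Variables (V : finType) (e : rel V).
Hypothesis e_sym : symmetric e.

(** Taken relative to a vertex set [W], so that the induction can delete closed neighbourhoods
    without changing the vertex type; maximality is phrased as domination. *)
Definition max_independent (W S : {set V}) : bool :=
  [&& S \subset W, [forall u in S, forall v in S, ~~ e u v] &
      [forall v in W :\: S, exists u in S, e v u]].

Lemma max_independentP (W S : {set V}) :
  reflect [/\ S \subset W, forall u v, u \in S -> v \in S -> e u v = false &
            forall v, v \in W -> v \notin S -> exists2 u, u \in S & e v u]
          (max_independent W S).
Proof.
apply: (iffP and3P) => [[sSW indS domS]|[sSW indS domS]]; split=> //.
- by move=> u v uS vS; apply/negbTE/(forall_inP (forall_inP indS u uS)).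
- by move=> v vW vS; apply/exists_inP/(forall_inP domS); rewrite inE vS.
- by apply/forall_inP=> u uS; apply/forall_inP=> v vS; rewrite indS.
- by apply/forall_inP=> v /setDP[vW vS]; apply/exists_inP/domS.
Qed.

Definition cnbhd (W : {set V}) (w : V) := [set u in W | (u == w) || e w u].

(** Removing [w] is injective on the sets that contain [w]. What remains avoids the neighbours of
    [w] by independence, and a vertex outside the closed neighbourhood of [w] is dominated by an
    element other than [w]. *)
Lemma card_max_independent_at (W : {set V}) (w : V) :
  #|[set S | max_independent W S & w \in S]|
    <= #|[set S | max_independent (W :\: cnbhd W w) S]|.
Proof.
have injD : {in [set S | max_independent W S & w \in S] &,
             injective (fun S => S :\ w)}.
  move=> S T; rewrite !inE => /andP[_ wS] /andP[_ wT] eqST.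
  by rewrite -(setD1K wS) eqST setD1K.
rewrite -(card_in_imset injD); apply/subset_leq_card/subsetP=> _ /imsetP[S + ->].
rewrite !inE => /andP[/max_independentP[/subsetP sSW indS domS] wS].
apply/max_independentP; split.
- apply/subsetP=> v; rewrite !inE => /andP[vw vS].
  by rewrite (negbTE vw) (indS w v) // sSW.
- by move=> u v /setD1P[_ uS] /setD1P[_ vS]; apply: indS.
- move=> v /setDP[vW]; rewrite !inE vW /= negb_or => /andP[vw wv]; rewrite vw /=.
  move=> vS; have [u uS vu] := domS v vW vS; exists u => //; rewrite !inE uS andbT.
  by apply: contraNneq wv => <-; rewrite e_sym.
Qed.

(* Every maximal independent set meets the closed neighbourhood of a vertex v;
   for v of minimum degree d, each of its d + 1 elements w leaves at most
   #|W| - (d + 1) vertices outside its own closed neighbourhood. *)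
Lemma card_max_independent (W : {set V}) :
  #|[set S | max_independent W S]| <= moon_moser #|W|.
Proof.
have [m] := ubnP #|W|; elim: m W => // m IH W leWm.
have [->|[v0 v0W]] := set_0Vmem W.
  rewrite cards0 /= -[X in _ <= X](cards1 (@set0 V)).
  apply/subset_leq_card/subsetP=> S; rewrite !inE => /and3P[].
  by rewrite subset0.
pose v := [arg min_(v < v0 in W) #|cnbhd W v|].
have [vW minv] : v \in W /\ forall w, w \in W -> #|cnbhd W v| <= #|cnbhd W w|.
  by rewrite /v; case: arg_minnP.
have inc w : w \in W -> w \in cnbhd W w by move=> wW; rewrite !inE wW eqxx.
have sub w : cnbhd W w \subset W by apply/subsetP=> u; rewrite inE => /andP[].
have cov : [set S | max_independent W S] \subset
    \bigcup_(w in cnbhd W v) [set S | max_independent W S & w \in S].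
  apply/subsetP=> S; rewrite inE => mS; have /max_independentP[sSW _ domS] := mS.
  have [vS|vS] := boolP (v \in S).
    by apply/bigcupP; exists v; rewrite ?inc // inE mS.
  have [u uS vu] := domS v vW vS; apply/bigcupP; exists u; last by rewrite inE mS.
  by rewrite !inE vu orbT (subsetP sSW).
apply: leq_trans (subset_leq_card cov) _.
apply: leq_trans (leq_card_bigcup _ _) _.
pose d := #|cnbhd W v|.
apply: (@leq_trans (\sum_(w in cnbhd W v) moon_moser (#|W| - d))).
  apply: leq_sum => w wN; have wW := subsetP (sub v) w wN.
  apply: leq_trans (card_max_independent_at W w) _.
  have cD : #|W :\: cnbhd W w| = #|W| - #|cnbhd W w|.
    by rewrite cardsD (setIidPr (sub w)).
  have c0 : 0 < #|cnbhd W w| by apply/card_gt0P; exists w; apply: inc.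
  have cW := subset_leq_card (sub w).
  apply: leq_trans (IH _ _) _; first by rewrite cD; lia.
  by apply: moon_moser_leq; rewrite cD leq_sub2l // minv.
rewrite sum_nat_const -/d; apply: leq_trans (moon_moser_mul _ _) _.
by rewrite subnK // subset_leq_card.
Qed.

End MaximalIndependentSets.

(** An undominated vertex could be added to an independent set, while a dominated one cannot belong
    to a larger independent set. *)
Lemma maximal_transversal01E (V : finType) (E : {set {set V}}) (S : {set V}) :
  uniform 2 E ->
  is_maximal_A_transversal (pred2 0 1) E S = max_independent (adj E) setT S.
Proof.
move=> uniE; apply/maximal_A_transversalP/max_independentP => [[]|[_ indS domS]].
  rewrite transversal01E // => indS maxS; split=> [|u v uS vS|v _ vS].
  - exact: subsetT.
  - by apply/negbTE/(forall_inP (forall_inP indS u uS)).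
  apply/exists_inP; apply: contraNT vS => /exists_inPn nv.
  rewrite -(maxS (v |: S)) ?setU11 ?subsetUr // transversal01E //.
  apply/forall_inP=> x; rewrite 2!inE => /predU1P[->|xS];
    apply/forall_inP=> y; rewrite 2!inE => /predU1P[->|yS].
  - by rewrite adj_irr.
  - exact: nv.
  - by rewrite adj_sym; exact: nv.
  - exact: (forall_inP (forall_inP indS x xS)).
split.
  rewrite transversal01E //; apply/forall_inP=> u uS; apply/forall_inP=> v vS.
  by rewrite indS.
move=> T sST; rewrite transversal01E // => indT; apply/eqP.
rewrite eqEsubset sST andbT; apply/subsetP=> v vT; apply/negPn/negP=> vS.
have [u uS] := domS v (in_setT v) vS; apply/negP.
exact: (forall_inP (forall_inP indT v vT)) (subsetP sST u uS).
Qed.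

(** * The graph of a symmetric irreflexive relation *)

Section GraphOfRelation.
Variables (V : finType) (e : rel V).
Hypotheses (e_sym : symmetric e) (e_irr : irreflexive e).

Definition edges : {set {set V}} :=
  [set H | [exists u, exists v, e u v && (H == [set u; v])]].

Lemma uniform_edges : uniform 2 edges.
Proof.
apply/forall_inP=> H; rewrite inE => /existsP[u /existsP[v /andP[uv /eqP->]]].
by rewrite cards2 (contraTneq _ uv) // => ->; rewrite e_irr.
Qed.

Lemma adj_edges : adj edges =2 e.
Proof.
move=> u v; rewrite /adj /= inE; apply/andP/idP => [[uv]|uv]; last first.
  split; first by apply: contraTneq uv => ->; rewrite e_irr.
  by apply/existsP; exists u; apply/existsP; exists v; rewrite uv eqxx.
case/existsP=> x /existsP[y /andP[xy /eqP eqH]].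
have : x \in [set u; v] by rewrite eqH set21.
have : y \in [set u; v] by rewrite eqH set22.
rewrite !inE => /orP[]/eqP yE /orP[]/eqP xE; subst x y; rewrite ?e_irr // in xy *.
by rewrite e_sym.
Qed.

End GraphOfRelation.

(** * Exact counts, and general bounds for [g] and [h] *)

Lemma card_transversals0 (V : finType) (E : {set {set V}}) :
  uniform 2 E -> no_isolated E ->
  #|[set S | is_A_transversal (pred1 0) E S]| = 1.
Proof.
move=> uE /(no_isolatedP uE) noI; rewrite -[RHS](cards1 (@set0 V)).
apply: eq_card => S; rewrite !inE; apply/(A_transversalP uE)/eqP => [tS|-> u v _].
  apply/setP=> v; rewrite inE; apply/negP=> vS; have [u vu] := noI v.
  by have := tS v u vu; rewrite vS.
by rewrite !inE.
Qed.

Lemma card_transversals012 (V : finType) (E : {set {set V}}) :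
  uniform 2 E -> #|[set S | is_A_transversal (pred3 0 1 2) E S]| = 2 ^ #|V|.
Proof.
move=> uE; rewrite -cardsT -card_powerset powersetT.
apply: eq_card => S; rewrite !inE; apply/(A_transversalP uE)=> u v _.
by case: (u \in S); case: (v \in S).
Qed.

Lemma g_leq (A : {pred nat}) n m :
  (forall E : {set {set 'I_n}}, uniform 2 E -> no_isolated E ->
     #|[set S | is_A_transversal A E S]| <= m) ->
  g 2 A n <= m.
Proof. by move=> le; apply/bigmax_leqP=> E /andP[]; apply: le. Qed.

Lemma leq_g (A : {pred nat}) n (E : {set {set 'I_n}}) :
  uniform 2 E -> no_isolated E ->
  #|[set S | is_A_transversal A E S]| <= g 2 A n.
Proof.
by move=> uE nE; rewrite /g (bigD1 E) ?uE ?nE //= leq_maxl.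
Qed.

Lemma h_leq (A : {pred nat}) n m :
  (forall E : {set {set 'I_n}}, uniform 2 E ->
     #|[set S | is_maximal_A_transversal A E S]| <= m) ->
  h 2 A n <= m.
Proof. by move=> le; apply/bigmax_leqP. Qed.

Lemma leq_h (A : {pred nat}) n (E : {set {set 'I_n}}) :
  uniform 2 E -> #|[set S | is_maximal_A_transversal A E S]| <= h 2 A n.
Proof. by move=> uE; rewrite /h (bigD1 E) //= leq_maxl. Qed.

(** In the edgeless hypergraph every set is an [A]-transversal, so the full set is a maximal one. *)
Lemma h_gt0 (A : {pred nat}) n : 0 < h 2 A n.
Proof.
have u0 : uniform 2 (set0 : {set {set 'I_n}}) by apply/forall_inP=> H; rewrite inE.
apply: leq_trans (leq_h A u0); apply/card_gt0P; exists setT.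
rewrite inE; apply/maximal_A_transversalP; split.
  by apply/forall_inP=> H; rewrite inE.
by move=> S; rewrite subTset => /eqP.
Qed.

(** The hypothesis is closure under union on one edge: [a], [b] tell which ends lie in the first
    set, [c], [d] which lie in the second. Two maximal transversals then both equal their union. *)
Lemma h_union_closed (A : {pred nat}) n :
  (forall a b c d : bool, a + b \in A -> c + d \in A ->
     ((a || c) + (b || d))%N \in A) ->
  h 2 A n = 1.
Proof.
move=> cA; apply/eqP; rewrite eqn_leq h_gt0 andbT; apply: h_leq => E uE.
apply/card_le1_eqP=> S T; rewrite !inE.
case/maximal_A_transversalP=> tS mS /maximal_A_transversalP[tT mT].
have tU : is_A_transversal A E (S :|: T).
  apply/(A_transversalP uE)=> u v uv; rewrite !inE; apply: cA.
    exact: (A_transversalP uE _ _ tS).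
  exact: (A_transversalP uE _ _ tT).
by rewrite -(mS _ (subsetUl _ _) tU) (mT _ (subsetUr _ _) tU).
Qed.

(** * Extremal graphs: stars, near-perfect matchings and disjoint cliques *)

Section Star.
Variable n : nat.
Hypothesis n_gt1 : 1 < n.

Definition star : {set {set 'I_n}} :=
  edges [rel u v : 'I_n | (u == 0 :> nat) != (v == 0 :> nat)].

Lemma adj_star (u v : 'I_n) : adj star u v = ((u == 0 :> nat) != (v == 0 :> nat)).
Proof.
by rewrite adj_edges // => [x y|x] /=; [rewrite eq_sym | rewrite eqxx].
Qed.

Lemma uniform_star : uniform 2 star.
Proof. by apply: uniform_edges => x /=; rewrite eqxx. Qed.

Lemma no_isolated_star : no_isolated star.
Proof.
apply/(no_isolatedP uniform_star)=> v.
have [v0|v0] := eqVneq (v : nat) 0.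
  by exists (Ordinal n_gt1); rewrite adj_star v0.
by exists (Ordinal (ltnW n_gt1)); rewrite adj_star (negbTE v0).
Qed.

(** The sets that avoid the centre are independent, and so is the centre alone. *)
Lemma card_transversals01_star :
  1 + 2 ^ (n - 1) <= #|[set S | is_A_transversal (pred2 0 1) star S]|.
Proof.
pose o : 'I_n := Ordinal (ltnW n_gt1).
have oE (v : 'I_n) : (v == 0 :> nat) = (v == o) by [].
have cP : #|powerset [set~ o]| = 2 ^ (n - 1).
  by rewrite card_powerset cardsC1 card_ord subn1.
have oP : [set o] \notin powerset [set~ o] by rewrite powersetE sub1set !inE eqxx.
(* The summand 1 is read as the truth value of [oP], so that [cardsU1] turns the sum into the size
   of one set. *)
rewrite -cP -[1 in X in X <= _]/(true : nat) -oP -cardsU1.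
apply/subset_leq_card/subsetP=> S; rewrite !inE => /orP[/eqP->|/subsetP sS];
  apply/(A_transversalP uniform_star)=> u v; rewrite adj_star !oE.
  by rewrite !inE; case: (u == o); case: (v == o).
have oS : o \in S = false by apply/negP=> /sS; rewrite !inE eqxx.
have [->|_] := eqVneq u o; first by rewrite oS; case: (v \in S).
have [->|//] := eqVneq v o; by rewrite oS; case: (u \in S).
Qed.

End Star.

(* Matches i with i + k for i < k := n %/ 2, and attaches the vertex 2k, present
   when n is odd, to 0. *)
Section Matching.
Variable n : nat.
Hypothesis n_gt1 : 1 < n.
Let k := n %/ 2.
Let k_gt0 : 0 < k. Proof. by rewrite divn_gt0. Qed.

Definition halves : rel nat := [rel u v | (k <= u) && (u %% k == v)].

Definition matching : {set {set 'I_n}} :=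
  edges [rel u v : 'I_n | halves u v || halves v u].

Lemma halves_lt u v : halves u v -> v < k <= u.
Proof. by case/andP=> ku /eqP <-; rewrite ltn_mod k_gt0. Qed.

Let irr : irreflexive [rel u v : 'I_n | halves u v || halves v u].
Proof.
by move=> x; rewrite /= orbb; apply/negP=> /halves_lt; rewrite ltnNge andNb.
Qed.

Lemma adj_matching (u v : 'I_n) : adj matching u v = halves u v || halves v u.
Proof. by rewrite adj_edges // => x y; rewrite /= orbC. Qed.

Lemma uniform_matching : uniform 2 matching.
Proof. exact: uniform_edges irr. Qed.

Lemma no_isolated_matching : no_isolated matching.
Proof.
apply/(no_isolatedP uniform_matching)=> v.
have [kv|vk] := leqP k v.
  have lt : v %% k < n by apply: leq_ltn_trans (leq_mod _ _) (ltn_ord v).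
  by exists (Ordinal lt); rewrite adj_matching /halves /= kv eqxx.
have lt : v + k < n by have := leq_divM n 2; rewrite -/k; lia.
exists (Ordinal lt); rewrite adj_matching /halves /= leq_addl modnDr modn_small //.
by rewrite eqxx orbT.
Qed.

(** [T] is an arbitrary choice on the vertices below [k], copied to the others modulo [k]. With [b]
    false the ends of an edge agree, giving a [{0,2}]-transversal; with [b] true the copy is
    complemented, giving a [{1}]-transversal. *)
Definition side (b : bool) (T : {set 'I_k}) : {set 'I_n} :=
  [set v : 'I_n | (Ordinal (ltn_pmod v k_gt0) \in T) (+) (b && (k <= v))].

Lemma side_inj b : injective (side b).
Proof.
move=> S T /setP eqST; apply/setP=> i.
have lt : i < n by apply: leq_trans (ltn_ord i) (leq_div _ _).
have := eqST (Ordinal lt); rewrite !inE /= leqNgt ltn_ord andbF !addbF.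
by rewrite (_ : Ordinal _ = i) //; apply: val_inj; rewrite /= modn_small.
Qed.

Lemma card_sides b (F : {set {set 'I_n}}) :
  (forall T, side b T \in F) -> 2 ^ k <= #|F|.
Proof.
move=> sF; rewrite -[k in 2 ^ k]card_ord -cardsT -card_powerset.
rewrite -(card_imset _ (@side_inj b)).
by apply/subset_leq_card/subsetP=> _ /imsetP[T _ ->].
Qed.

Lemma side_halves b T (u v : 'I_n) : halves u v ->
  (u \in side b T) = (v \in side b T) (+) b.
Proof.
move=> uv; have /andP[vk ku] := halves_lt uv.
rewrite !inE ku (leqNgt k v) vk andbF andbT addbF; congr ((_ \in T) (+) _).
by apply: val_inj; case/andP: uv => _ /eqP /= <-; rewrite modn_mod.
Qed.

Lemma side_adj b T (u v : 'I_n) : adj matching u v ->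
  (u \in side b T) = (v \in side b T) (+) b.
Proof.
rewrite adj_matching => /orP[]/side_halves-> //.
by rewrite -addbA addbb addbF.
Qed.

Lemma card_transversals02_matching :
  2 ^ k <= #|[set S | is_A_transversal (pred2 0 2) matching S]|.
Proof.
apply: (@card_sides false) => T; rewrite inE.
apply/(A_transversalP uniform_matching)=> u v /(side_adj false T)->.
by rewrite addbF; case: (v \in _).
Qed.

Lemma transversals1_matching T : is_A_transversal (pred1 1) matching (side true T).
Proof.
apply/(A_transversalP uniform_matching)=> u v /(side_adj true T)->.
by rewrite addbT; case: (v \in _).
Qed.

Lemma card_transversals1_matching :
  2 ^ k <= #|[set S | is_A_transversal (pred1 1) matching S]|.
Proof. by apply: (@card_sides true) => T; rewrite inE transversals1_matching. Qed.

(** Without isolated vertices every [{1}]-transversal is maximal: a vertex outside it has a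
    neighbour inside, so adding that vertex would fill an edge. *)
Lemma card_maximal_transversals1_matching :
  2 ^ k <= #|[set S | is_maximal_A_transversal (pred1 1) matching S]|.
Proof.
apply: (@card_sides true) => T; rewrite inE.
have tT := transversals1_matching T; apply/maximal_A_transversalP; split=> // S sTS.
move=> /(A_transversalP uniform_matching) tS; apply/eqP; rewrite eqEsubset sTS andbT.
apply/subsetP=> v vS; have [u vu] := no_isolatedP uniform_matching no_isolated_matching v.
have := tS v u vu; have := A_transversalP uniform_matching _ _ tT v u vu.
have := subsetP sTS u; rewrite vS; case: (v \in side _ _) => //.
by case: (u \in side _ _) => // /(_ isT) ->.
Qed.

End Matching.

(* The disjoint union of k := ceil (n / 3) cliques, the residue classes modulo
   k, of sizes 2 and 3. *)
Section MoonMoserGraph.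
Variable n : nat.
Hypothesis n_gt1 : 1 < n.
Let k := (n + 2) %/ 3.
Let k_gt0 : 0 < k. Proof. by rewrite divn_gt0 // addn2 !ltnS ltnW. Qed.
Let cls (v : 'I_n) : 'I_k := Ordinal (ltn_pmod v k_gt0).
Let same : rel 'I_n := [rel u v | (u != v) && (cls u == cls v)].

Let same_sym : symmetric same.
Proof. by move=> u v; rewrite /same /= eq_sym (eq_sym (cls u)). Qed.

Let same_irr : irreflexive same.
Proof. by move=> u; rewrite /same /= eqxx. Qed.

Definition cliques : {set {set 'I_n}} := edges same.

Lemma uniform_cliques : uniform 2 cliques.
Proof. exact: uniform_edges. Qed.

(** The class of [i] contains [i] and [i + k], since [2 * k <= n], and also [i + 2 * k] when
    [i < n - 2 * k]. *)
Lemma card_cls (i : 'I_k) :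
  (if i < n - 2 * k then 3 else 2) <= #|[pred v | cls v == i]|.
Proof.
set c := if _ then _ else _.
have k_le : 2 * k <= n by rewrite /k; lia.
have lt m : m < c -> i + m * k < n.
  rewrite /c; have := ltn_ord i.
  by case: m => [|[|[|m]]]; case: ifP => //; lia.
pose f (m : 'I_c) := Ordinal (lt m (ltn_ord m)).
have injf : injective f.
  move=> m m' /(congr1 val) /= /addnI/eqP.
  by rewrite eqn_pmul2r // => /eqP/val_inj.
apply: (@leq_trans #|'I_c|); first by rewrite card_ord.
rewrite -(card_codom injf); apply/subset_leq_card/subsetP=> _ /codomP[m ->].
by rewrite inE; apply/eqP/val_inj; rewrite /= addnC modnMDl modn_small.
Qed.

Lemma prod_if_lt a m :
  a <= m -> \prod_(i < m) (if i < a then 3 else 2) = 3 ^ a * 2 ^ (m - a).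
Proof.
elim: m => [|m IH] le; first by case: a le; rewrite ?big_ord0.
rewrite big_ord_recr /=; have [lt|ge] := ltnP m a.
  have <- : m.+1 = a by lia.
  rewrite subnn muln1 expnSr; congr (_ * _).
  rewrite (eq_bigr (fun=> 3)) ?prod_nat_const ?card_ord // => i _.
  by rewrite (ltn_trans (ltn_ord i)).
by rewrite IH // subSn // expnSr mulnA.
Qed.

(** The number of classes of size 2 is [3 * k - n], which is 0, 2 or 1 as [n] is 0, 1 or 2 modulo
    3. *)
Lemma prod_moon_moser :
  3 ^ (n - 2 * k) * 2 ^ (k - (n - 2 * k)) = moon_moser n.
Proof.
rewrite moon_moserE; last by lia.
have := divn_eq n 3; have := ltn_pmod n (isT : 0 < 3).
set q := n %/ 3; set r := n %% 3 => r_lt3 nE.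
have [r0|[r1|r2]] : r = 0 \/ r = 1 \/ r = 2 by lia.
- have -> : k = q by rewrite /k; lia.
  have -> : n - 2 * q = q by lia.
  by rewrite r0 subnn muln1.
- have -> : k = q.+1 by rewrite /k; lia.
  have -> : n - 2 * q.+1 = q - 1 by lia.
  have -> : q.+1 - (q - 1) = 2 by lia.
  by rewrite r1 mulnC.
- have -> : k = q.+1 by rewrite /k; lia.
  have -> : n - 2 * q.+1 = q by lia.
  by rewrite r2 subSnn mulnC.
Qed.

(** Choosing one vertex from each clique gives a maximal independent set, and the set determines the
    choice; the choices are counted by the product of the clique sizes. *)
Lemma card_maximal_transversals01_cliques :
  moon_moser n <= #|[set S | is_maximal_A_transversal (pred2 0 1) cliques S]|.
Proof.
pose F (i : 'I_k) : pred 'I_n := [pred v | cls v == i].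
pose sel (t : {ffun 'I_k -> 'I_n}) := [set v | t (cls v) == v].
have famP t : t \in family F -> forall i, cls (t i) = i.
  by move=> /familyP tF i; apply/eqP; have := tF i; rewrite inE.
have injs : {in family F &, injective sel}.
  move=> s t /famP sF /famP tF /setP eqst; apply/ffunP=> i.
  by have := eqst (s i); rewrite !inE sF eqxx => /esym/eqP.
apply: (@leq_trans #|family F|).
  rewrite -prod_moon_moser -prod_if_lt; last by rewrite /k; lia.
  rewrite card_family foldrE big_image /=.
  by apply: leq_prod => i _; apply: card_cls.
rewrite -(card_in_imset injs); apply/subset_leq_card/subsetP=> _ /imsetP[t /famP tF ->].
rewrite inE maximal_transversal01E ?uniform_cliques //; apply/max_independentP; split.
- exact: subsetT.
- move=> u v; rewrite !inE => /eqP tu /eqP tv; rewrite adj_edges //.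
  apply/negP=> /andP[uv /eqP cuv]; case/eqP: uv.
  by rewrite -tu cuv tv.
- move=> v _; rewrite inE => tv; exists (t (cls v)); first by rewrite inE tF.
  by rewrite adj_edges // /same /= tF eqxx eq_sym tv.
Qed.

End MoonMoserGraph.

(** * Evaluation of [g] and [h] *)

(** The star shows that the maximum ranges over a non-empty family; over an empty one it would be
    0. *)
Lemma g_const (A : {pred nat}) n m :
  1 < n ->
  (forall E : {set {set 'I_n}}, uniform 2 E -> no_isolated E ->
     #|[set S | is_A_transversal A E S]| = m) ->
  g 2 A n = m.
Proof.
move=> n_gt1 cE; apply/eqP; rewrite eqn_leq; apply/andP; split.
  by apply: g_leq => E uE nE; rewrite cE.
rewrite -(cE _ (uniform_star n) (no_isolated_star n_gt1)).
exact: leq_g (uniform_star n) (no_isolated_star n_gt1).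
Qed.

Lemma g_setC (A B : {pred nat}) n :
  (forall i, i <= 2 -> (i \in A) = (2 - i \in B)) -> g 2 A n = g 2 B n.
Proof.
by move=> AB; apply: eq_bigr => E /andP[uE _]; apply: card_transversals_setC.
Qed.

Theorem theorem3 :
  (forall n : nat, 2 <= n ->
     g 2 (pred1 0) n = 1 /\
     g 2 (pred1 1) n = 2 ^ (n %/ 2) /\
     g 2 (pred1 2) n = 1 /\
     g 2 (pred2 0 1) n = 1 + 2 ^ (n - 1) /\
     g 2 (pred2 1 2) n = 1 + 2 ^ (n - 1) /\
     g 2 (pred2 0 2) n = 2 ^ (n %/ 2) /\
     g 2 (pred3 0 1 2) n = 2 ^ n) /\
  (forall n : nat, 1 <= n ->
     h 2 (pred1 0) n = 1 /\
     h 2 (pred1 1) n = 2 ^ (n %/ 2) /\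
     h 2 (pred1 2) n = 1 /\
     h 2 (pred2 1 2) n = 1 /\
     h 2 (pred2 0 2) n = 1 /\
     h 2 (pred3 0 1 2) n = 1 /\
     (n <> 1 ->
      h 2 (pred2 0 1) n =
        if n %% 3 == 0 then 3 ^ (n %/ 3)
        else if n %% 3 == 1 then 4 * 3 ^ (n %/ 3 - 1)
        else 2 * 3 ^ (n %/ 3))).
Proof.
split=> n n_gt.
  have um := uniform_matching n_gt; have nm := no_isolated_matching n_gt.
  have us := uniform_star n; have ns := no_isolated_star n_gt.
  have g0 : g 2 (pred1 0) n = 1 by apply: g_const => //; exact: card_transversals0.
  have g01 : g 2 (pred2 0 1) n = 1 + 2 ^ (n - 1).
    apply/eqP; rewrite eqn_leq; apply/andP; split.
      apply: g_leq => E uE nE; rewrite -[n in n - 1]card_ord.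
      by apply: card_transversals01; rewrite ?card_ord // ltnW.
    exact: leq_trans (card_transversals01_star n_gt) (leq_g _ us ns).
  split=> //; split; [|split; [|split=> //; split; [|split]]].
  - apply/eqP; rewrite eqn_leq; apply/andP; split.
      apply: g_leq => E uE nE; rewrite -[n in n %/ 2]card_ord.
      exact: card_transversals1.
    exact: leq_trans (card_transversals1_matching n_gt) (leq_g _ um nm).
  (* Complementation carries [{2}] to [{0}], and below it carries [{1,2}] to [{0,1}]. *)
  - by apply: etrans g0; apply: g_setC; do 3!case=> //.
  - by apply: etrans g01; apply: g_setC; do 3!case=> //.
  - apply/eqP; rewrite eqn_leq; apply/andP; split.
      apply: g_leq => E uE nE; rewrite -[n in n %/ 2]card_ord.
      exact: card_transversals02.
    exact: leq_trans (card_transversals02_matching n_gt) (leq_g _ um nm).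
  - by apply: g_const => // E uE _; rewrite card_transversals012 ?card_ord.
have hU (A : {pred nat}) := @h_union_closed A n.
(* All the sets except [{1}] and [{0,1}] satisfy the union closure condition; these two cases
   remain. *)
do 6?[split; try by apply: hU; do 4!case].
  apply/eqP; rewrite eqn_leq; apply/andP; split.
    apply: h_leq => E uE; rewrite -[n in n %/ 2]card_ord.
    exact: card_maximal_transversals1.
  (* A single vertex admits no matching, but there the bound is [2 ^ 0 = 1]. *)
  case: n n_gt {hU} => [|[|n]] // _; first exact: h_gt0.
  have n_gt1 : 1 < n.+2 by [].
  apply: leq_trans (card_maximal_transversals1_matching n_gt1) _.
  exact: leq_h (uniform_matching n_gt1).
move=> n_neq1; have n_gt1 : 1 < n by lia.
rewrite -moon_moserE //; apply/eqP; rewrite eqn_leq; apply/andP; split.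
  apply: h_leq => E uE; rewrite -[n in moon_moser n]card_ord -cardsT.
  apply: leq_trans (card_max_independent (@adj_sym _ E) _).
  by apply/subset_leq_card/subsetP=> S; rewrite !inE maximal_transversal01E.
apply: leq_trans (card_maximal_transversals01_cliques n_gt1) _.
exact: leq_h (uniform_cliques n_gt1).
Qed.
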